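(* Let $(X,\mathcal{A},\mu)$ be a measure space and let $I$ be an ideal (not necessarily proper) in $\mathcal{M}(X,\mathcal{A})$. The connected component of $0$ in $\mathcal{M}(X,\mathcal{A})$ equipped with the $m_\mu^I$-topology is $I\cap L_\psi(X,\mathcal{A},\mu)$.
   Context: $X$ is a non-empty set, $\mathcal{A}$ a $\sigma$-algebra on $X$, $\mu:\mathcal{A}\to[0,\infty]$ a measure. $\mathcal{M}(X,\mathcal{A})$ is the commutative ring of all measurable functions $X\to\mathbb{R}$ under pointwise operations. A $\mu$-null set is a set $E\in\mathcal{A}$ with $\mu(E)=0$. A positive unit of $\mathcal{M}(X,\mathcal{A})$ is a $u\in\mathcal{M}(X,\mathcal{A})$ with $u(x)>0$ for all $x\in X$. For an ideal $I$, $f\in\mathcal{M}(X,\mathcal{A})$ and a positive unit $u$, put $m_\mu(f,I,u)=\{g\in\mathcal{M}(X,\mathcal{A}): g-f\in I$ and there is a $\mu$-null set $E$ with $|f(x)-g(x)|<u(x)$ for all $x\in X\setminus E\}$. These sets form an open base of the $m_\mu^I$-topology on $\mathcal{M}(X,\mathcal{A})$. $L^\infty(X,\mathcal{A},\mu)$ denotes the set of all essentially bounded $f\in\mathcal{M}(X,\mathcal{A})$, i.e. those for which there is a $\mu$-null set $E$ such that $f$ is bounded on $X\setminus E$ (functions are not identified when equal almost everywhere). $L_\psi(X,\mathcal{A},\mu)=\{f\in\mathcal{M}(X,\mathcal{A}): f\cdot g\in L^\infty(X,\mathcal{A},\mu)$ for all $g\in\mathcal{M}(X,\mathcal{A})\}$.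 *)

(* Defs.v *)
From HB Require Import structures.
From mathcomp Require Import all_boot all_order all_algebra.
From mathcomp Require Import all_classical all_reals all_analysis.
From mathcomp Require Import measurable_realfun.

Set Implicit Arguments.
Unset Strict Implicit.
Unset Printing Implicit Defensive.

Import Order.TTheory GRing.Theory Num.Theory.

Local Open Scope classical_set_scope.
Local Open Scope ring_scope.

(* Unlike mathcomp's [idealr_closed], this allows the whole ring. *)
Record ideal (A : comNzRingType) := Ideal {
  ideal_set :> set A ;
  ideal0 : ideal_set 0 ;
  idealD : forall f g, ideal_set f -> ideal_set g -> ideal_set (f + g) ;
  idealMl : forall a f, ideal_set f -> ideal_set (a * f) }.

Section function_ring.
Context d (X : measurableType d) (R : realType).
Variable mu : {measure set X -> \bar R}.
Local Notation M := {mfun X >-> R}.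

Definition null_set (E : set X) := measurable E /\ mu E = 0%E.

Definition positive_unit (u : M) := forall x, 0 < u x.

Definition m_mu (f : M) (I : ideal M) (u : M) : set M :=
  [set g | ideal_set I (g - f) /\
    exists2 E, null_set E & forall x, ~ E x -> `|f x - g x| < u x].

Definition Linfty : set M :=
  [set f | exists2 E, null_set E &
    exists K : R, forall x, ~ E x -> `|f x| <= K].

Definition Lpsi : set M := [set f | forall g : M, Linfty (f * g)].

Lemma null_setU E F : null_set E -> null_set F -> null_set (E `|` F).
Proof.
move=> [mE E0] [mF F0]; split; first exact: measurableU.
by rewrite null_set_setU.
Qed.

Lemma m_mu_refl (f : M) (I : ideal M) (u : M) :
  positive_unit u -> m_mu f I u f.
Proof.
move=> u0; split; first by rewrite subrr; exact: ideal0.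
exists set0; first by split=> //; exact: measure0.
by move=> x _; rewrite subrr normr0; exact: u0.
Qed.

Lemma m_mu_join (I : ideal M) (f1 u1 f2 u2 g : M) :
    m_mu f1 I u1 g -> m_mu f2 I u2 g ->
  exists2 u, positive_unit u & m_mu g I u `<=` m_mu f1 I u1 `&` m_mu f2 I u2.
Proof.
move=> [I1 [E1 nE1 h1]] [I2 [E2 nE2 h2]].
pose v x := Num.min (u1 x - `|f1 x - g x|) (u2 x - `|f2 x - g x|).
have mv : measurable_fun setT v.
  by apply: measurable_minr; apply: measurable_funB => //;
    apply/measurableT_comp => //; exact: measurable_funB.
have mw : measurable_fun setT (fun x => if 0 < v x then v x else 1).
  by apply: measurable_fun_ifT => //; exact: measurable_fun_ltr.
pose u : M := mfun_Sub (mem_set mw).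
have uE x : u x = if 0 < v x then v x else 1 by [].
exists u => [x|h [Ih [E nE hE]]]; first by rewrite uE; case: ifPn.
have hv x : ~ E1 x -> ~ E2 x -> ~ E x -> `|g x - h x| < v x.
  move=> n1 n2 n; have := hE x n; rewrite uE ifT//.
  by rewrite lt_min !subr_gt0 h1// h2.
split; split.
- by rewrite -(subrKA g); apply: idealD.
- exists (E1 `|` E2 `|` E); first by do 2 apply: null_setU => //.
  move=> x /not_orP[/not_orP[n1 n2] n].
  rewrite (le_lt_trans (ler_distD (g x) _ _))// -ltrBrDl.
  by have := hv x n1 n2 n; rewrite lt_min => /andP[].
- by rewrite -(subrKA g); apply: idealD.
- exists (E1 `|` E2 `|` E); first by do 2 apply: null_setU => //.
  move=> x /not_orP[/not_orP[n1 n2] n].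
  rewrite (le_lt_trans (ler_distD (g x) _ _))// -ltrBrDl.
  by have := hv x n1 n2 n; rewrite lt_min => /andP[].
Qed.

End function_ring.

(* The function ring, carrying the topology whose open base consists of the
   sets [m_mu mu f I u] with [u] a positive unit; the base is indexed by the
   pairs [(f, u)]. *)
Definition m_mu_space d (X : measurableType d) (R : realType)
  (mu : {measure set X -> \bar R}) (I : ideal {mfun X >-> R}) : Type :=
  {mfun X >-> R}.

Definition m_mu_index d (X : measurableType d) (R : realType) : Type :=
  ({mfun X >-> R} * {mfun X >-> R})%type.

HB.instance Definition _ d (X : measurableType d) (R : realType) :=
  Choice.on (m_mu_index X R).
HB.instance Definition _ d (X : measurableType d) (R : realType) :=
  isPointed.Build (m_mu_index X R) (0, 0).

Section m_mu_topology.
Context d (X : measurableType d) (R : realType).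
Variables (mu : {measure set X -> \bar R}) (I : ideal {mfun X >-> R}).
Local Notation M := {mfun X >-> R}.

HB.instance Definition _ := GRing.ComNzRing.on (m_mu_space mu I).

Let index := m_mu_index X R.

Let D : set index := [set i | positive_unit i.2].
Let b (i : index) : set (m_mu_space mu I) := m_mu mu i.1 I i.2.

Let b_cover : \bigcup_(i in D) b i = setT.
Proof.
apply/seteqP; split=> // f _.
have u1 : positive_unit (1 : M) by move=> x; exact: ltr01.
by exists (f : M, 1 : M) => //; exact: m_mu_refl.
Qed.

Let b_join i j t : D i -> D j -> b i t -> b j t ->
  exists k, [/\ D k, b k t & b k `<=` b i `&` b j].
Proof.
move=> _ _ bi bj; have [u u0 sub] := m_mu_join bi bj.
by exists (t : M, u); split=> //; exact: m_mu_refl.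
Qed.

HB.instance Definition _ :=
  isBaseTopological.Build (m_mu_space mu I) b_cover b_join.

Lemma m_mu_open (A : set (m_mu_space mu I)) :
  open A <-> forall f : M, A f ->
    exists2 u : M, positive_unit u & m_mu mu f I u `<=` A.
Proof.
split=> [[B BD <-] f [i Bi bif]|H].
  have [u u0 sub] := m_mu_join bif bif.
  by exists u => // g /sub[big _]; exists i.
exists [set i | D i /\ b i `<=` A]; first by move=> i [].
apply/seteqP; split=> [f [i [_ +]]|f Af]; first exact.
have [u u0 sub] := H f Af.
by exists (f : M, u) => //; exact: m_mu_refl.
Qed.

End m_mu_topology.

(* Main.v *)
(** The sets [I] and [{h | h g is essentially bounded}] are clopen for every
    measurable [g], the latter because the unit [1 / (1 + |g|)] moves [h g] by
    at most [1]; this traps the component of [0] in [I `&` Lpsi mu].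
    Conversely, if [f] is in [I `&` Lpsi mu] then [f / u] is essentially bounded
    for every positive unit [u], so [t |-> t f] is continuous and joins [0]
    to [f]. *)
Require Import Defs.
From mathcomp Require Import all_boot all_order all_algebra.
From mathcomp Require Import all_classical all_reals all_analysis.
From mathcomp Require Import measurable_realfun.

Set Implicit Arguments.
Unset Strict Implicit.

Import Order.TTheory GRing.Theory Num.Theory.
Import numFieldNormedType.Exports.

Local Open Scope classical_set_scope.
Local Open Scope ring_scope.

(** A connected set [C] through [x] meets [U] in a nonempty relatively clopen subset, which must be
    all of [C]. *)
Lemma connected_component_sub_clopen {T : topologicalType} (U : set T) (x : T) :
  open U -> open (~` U) -> U x -> connected_component [set: T] x `<=` U.
Proof.
move=> oU oCU Ux y [C [Cx _ cC] Cy].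
suff UC : C `&` U = C by move: Cy; rewrite -UC => -[].
apply: cC; [by exists x | by exists U | exists U => //].
by rewrite -openC.
Qed.

Section function_ring.
Context {R : realType} {d : measure_display} {X : measurableType d}.
Local Notation M := {mfun X >-> R}.

Lemma positive_unit1 : positive_unit (1 : M).
Proof. by move=> x; exact: ltr01. Qed.

Lemma mfun_inv (u : M) : (forall x, 0 < u x) ->
  {v : M | forall x, v x = (u x)^-1}.
Proof.
move=> u0.
(* The power with exponent [-1] is measurable and agrees with the inverse at positive reals. *)
have mv : measurable_fun setT (fun x => u x `^ (-1)).
  by apply: (measurableT_comp (measurable_powR _)).
by exists (mfun_Sub (mem_set mv)) => x; rewrite -powR_inv1 ?ltW.
Qed.

Lemma mfun_abs1 (g : M) : {w : M | forall x, w x = 1 + `|g x|}.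
Proof.
have mw : measurable_fun setT (fun x => 1 + `|g x|).
  by apply: measurable_funD => //; exact/measurableT_comp.
by exists (mfun_Sub (mem_set mw)).
Qed.

Variables (mu : {measure set X -> \bar R}) (I : ideal M).

Lemma idealN (f : M) : ideal_set I f -> ideal_set I (- f).
Proof. by move=> If; rewrite -mulN1r; exact: idealMl. Qed.

Lemma m_mu_sym (f g u : M) : m_mu mu f I u g -> m_mu mu g I u f.
Proof.
move=> [If [E nE hE]]; split; first by rewrite -opprB; exact: idealN.
by exists E => // x nx; rewrite distrC; exact: hE.
Qed.

(** The unit depends on [g] alone and serves all [h] at once, as [component_sub_stable] demands. *)
Lemma m_mu_Linfty (g : M) : exists2 u : M, positive_unit u &
  forall h k, m_mu mu h I u k -> Linfty mu (h * g) -> Linfty mu (k * g).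
Proof.
have [w wE] := mfun_abs1 g.
have w0 x : 0 < w x by rewrite wE ltr_pwDl.
have [u uE] := mfun_inv w0.
exists u => [x|h k [_ [E nE hE]] [F nF [K hK]]].
  by rewrite uE invr_gt0.
exists (E `|` F); first exact: Defs.null_setU.
(* [K] bounds [h * g], and [1] bounds [(h - k) * g], whose modulus is at most [|g| / (1 + |g|)]. *)
exists (1 + K) => x /not_orP[nEx nFx].
have -> : (k * g) x = (h * g) x - (h x - k x) * g x.
  by rewrite !mfunM/= mulrBl subKr.
rewrite (le_trans (ler_normB _ _))// addrC lerD ?hK// normrM.
have /ltW le_u := hE x nEx.
rewrite (le_trans (ler_wpM2r _ le_u))// uE mulrC ler_pdivrMr// mul1r wE.
by rewrite lerDr.
Qed.

(** Since [m_mu] is symmetric, a point outside [A] has no [u]-neighbour in [A]; so the complement is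
    stable under the same unit. *)
Lemma open_m_mu_stable (A : set (m_mu_space mu I)) (u : M) : positive_unit u ->
  (forall f g : M, m_mu mu f I u g -> A f -> A g) -> open A /\ open (~` A).
Proof.
move=> u0 st; split; apply/m_mu_open => f Af; exists u => // g fg.
  exact: st fg Af.
by move=> Ag; apply: Af; apply: st Ag; exact: m_mu_sym.
Qed.

Lemma component_sub_stable (A : set (m_mu_space mu I)) (u : M) :
  positive_unit u ->
  (forall f g : M, m_mu mu f I u g -> A f -> A g) -> A 0 ->
  connected_component [set: m_mu_space mu I] 0 `<=` A.
Proof.
move=> u0 st; have [oA oCA] := open_m_mu_stable u0 st.
exact: connected_component_sub_clopen.
Qed.

Lemma Lpsi_le_unit (f u : M) : Lpsi mu f -> positive_unit u ->
  exists2 K, 0 < K & exists2 E, Defs.null_set mu E &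
    forall x, ~ E x -> `|f x| <= K * u x.
Proof.
move=> Lf u0; have [v vE] := mfun_inv u0.
have [E nE [K hK]] := Lf v.
(* The bound [K] may be zero or negative; this larger one is positive, hence invertible in
   [line_continuous]. *)
exists (1 + `|K|); first by rewrite ltr_pwDl.
exists E => // x nx; rewrite -ler_pdivrMr//.
have := hK x nx; rewrite mfunM/= vE normrM (gtr0_norm (x := (u x)^-1)) ?invr_gt0//.
move=> /le_trans; apply.
by rewrite (le_trans (ler_norm K))// lerDr.
Qed.

(** Scaling is a ring product with a constant function, so differences of two points of the line are
    ring multiples of [f] and stay in [I]. *)
Definition line (f : M) (t : R) : m_mu_space mu I := (cst t : M) * f.

Lemma line_continuous (f : M) : ideal_set I f -> Lpsi mu f -> continuous (line f).
Proof.
move=> If Lf t V /=; rewrite nbhsE => -[B [oB Bt] BV].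
have [u u0 uB] := (m_mu_open B).1 oB _ Bt.
have [K K0 [E nE hE]] := Lpsi_le_unit Lf u0.
have K10 : 0 < K^-1 by rewrite invr_gt0.
suff : \forall s \near t, V (line f s) by [].
near=> s; apply: BV; apply: uB; split.
  by rewrite /line -mulrBl; exact: idealMl.
exists E => // x nx; rewrite /line !mfunM/= -mulrBl normrM.
(* Off [E], [|t - s| * |f x| <= |t - s| * K * u x], which is below [u x] as soon as
   [|t - s| < K^-1]. *)
rewrite (le_lt_trans (ler_wpM2l _ (hE x nx)))// mulrA gtr_pMl// -ltr_pdivlMr// div1r.
by near: s; exact: cvgr_dist_lt.
Unshelve. all: by end_near. Qed.

End function_ring.

Theorem theorem3p7 (R : realType) (d : measure_display) (X : measurableType d)
    (mu : {measure set X -> \bar R}) (I : ideal {mfun X >-> R}) :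
  connected_component [set: m_mu_space mu I] 0 = I `&` Lpsi mu.
Proof.
apply/seteqP; split=> [f Cf|f [If Lf]].
  split.
    apply: component_sub_stable positive_unit1 _ _ f Cf; last exact: ideal0.
    by move=> g h [Ihg _] Ig; rewrite -(subrK g h); exact: idealD.
  move=> g; have [u u0 st] := m_mu_Linfty mu I g.
  (* One stable set is used for each [g]; [Lpsi mu] is their intersection. *)
  apply: (component_sub_stable (A := [set h | Linfty mu (h * g)]) u0) Cf => //=.
  rewrite mul0r; exists set0; first by split=> //; exact: measure0.
  by exists 0 => x _; rewrite normr0.
exists (line mu I f @` `[0, 1]); last first.
  exists 1; first by rewrite /= in_itv/= lexx ler01.
  by apply/mfuneqP => x; rewrite /line mfunM/= mul1r.
split=> //.
  exists 0; first by rewrite /= in_itv/= lexx ler01.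
  by apply/mfuneqP => x; rewrite /line mfunM/= mul0r.
apply: connected_continuous_connected.
  exact: segment_connected.
exact/continuous_subspaceT/line_continuous.
Qed.
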